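(* Let $p\le q$ and let $(K_{p,q},\sigma)$ be a signed complete bipartite graph with bipartition $(U_p,V_q)$, $|U_p|=p$, $|V_q|=q$, whose negative edges induce $k$ pairwise vertex-disjoint complete bipartite subgraphs $K_{r_1,s_1},\dots,K_{r_k,s_k}$ (of orders $r_1+s_1,\dots,r_k+s_k$), where $K_{r_i,s_i}$ has $r_i$ vertices in $U_p$ and $s_i$ vertices in $V_q$, and $r=\sum_{i=1}^k r_i\le p$, $s=\sum_{i=1}^k s_i\le q$. Let $c=\sqrt{p-r}$ and, for $1\le i,j\le k$, let $c_{ij}=q$ if $i=j$ and $c_{ij}=q-2s_i-2s_j$ if $i\ne j$. Define the $(k+1)\times(k+1)$ matrix $Z'$ by $$Z'=\begin{pmatrix} r_1c_{11} & r_2c_{12} & \cdots & r_kc_{1k} & c(q-2s_1)\\ r_1c_{21} & r_2c_{22} & \cdots & r_kc_{2k} & c(q-2s_2)\\ \vdots & \vdots & \ddots & \vdots & \vdots\\ r_1c_{k1} & r_2c_{k2} & \cdots & r_kc_{kk} & c(q-2s_k)\\ r_1c(q-2s_1) & r_2c(q-2s_2) & \cdots & r_kc(q-2s_k) & q(p-r)\end{pmatrix}.$$ Then all eigenvalues of $Z'$ are real and nonnegative, and the characteristic polynomial of $(K_{p,q},\sigma)$ is $$\phi((K_{p,q},\sigma),x)=x^{p+q-2k-2}\,\phi(Z',x^2).$$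
   Context: A signed graph $\Gamma=(G,\sigma)$ consists of a simple graph $G$ and a sign function $\sigma:E(G)\to\{-1,1\}$; edges with sign $-1$ are negative. Its adjacency matrix $A(\Gamma)$ has $(i,j)$ entry $\sigma(v_iv_j)$ if $v_iv_j\in E(G)$ and $0$ otherwise. For a square matrix $Z$, $\phi(Z,x)=\det(xI-Z)$, and $\phi(\Gamma,x)=\phi(A(\Gamma),x)$. *)

(* Defs.v *)
From HB Require Import structures.
From mathcomp Require Import all_boot all_order all_algebra.
From mathcomp Require Import complex.
Set Implicit Arguments.
Unset Strict Implicit.
Unset Printing Implicit Defensive.
Import Order.TTheory GRing.Theory Num.Theory.
Local Open Scope ring_scope.

(* Edges are 2-element subsets of the vertex type T.  The value of sg_sign   *)
(* on sets that are not edges is irrelevant.                                 *)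
Record signed_graph (T : finType) := SignedGraph {
  sg_edges : {set {set T}};
  sg_sign : {set T} -> int;
  sg_edges_card : forall e, e \in sg_edges -> #|e| = 2%N;
  sg_signP : forall e, e \in sg_edges -> sg_sign e = -1 \/ sg_sign e = 1
}.

(* The vertices are numbered v_i = enum_val i, for i : 'I_#|T|.              *)
Definition sg_adjmx (R : pzRingType) (T : finType) (G : signed_graph T)
    : 'M[R]_#|T| :=
  \matrix_(i, j)
    let e := [set enum_val i; enum_val j] in
    if e \in sg_edges G then (sg_sign G e)%:~R else 0.

Definition negative_edges (T : finType) (G : signed_graph T)
    : {set {set T}} :=
  [set e in sg_edges G | sg_sign G e == -1].

Definition complete_bip_edges (T : finType) (A B : {set T}) : {set {set T}} :=
  [set [set a; b] | a in A, b in B].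

Definition complete_bipartite (T : finType) (G : signed_graph T)
    (U V : {set T}) : Prop :=
  [/\ U :|: V = [set: T], [disjoint U & V]
    & sg_edges G = complete_bip_edges U V].

Section Zprime.
Variables (R : rcfType) (k p q : nat) (r s : 'I_k -> nat).

Definition c_scal : R := Num.sqrt (p%:R - (\sum_i r i)%N%:R).

Definition c_coef (i j : 'I_k) : R :=
  if i == j then q%:R else q%:R - 2 * (s i)%:R - 2 * (s j)%:R.

Definition Zprime : 'M[R]_(k + 1) :=
  block_mx
    (\matrix_(i, j) ((r j)%:R * c_coef i j))
    (\col_i (c_scal * (q%:R - 2 * (s i)%:R)))
    (\row_j ((r j)%:R * c_scal * (q%:R - 2 * (s j)%:R)))
    (q%:R * (p%:R - (\sum_i r i)%N%:R))%:M.

End Zprime.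
Arguments Zprime R {k} p q r s.

(* Main.v *)
Require Import Defs.
From HB Require Import structures.
From mathcomp Require Import all_boot all_order all_algebra.
From mathcomp Require Import complex.
From mathcomp Require Import ring.
Import Order.TTheory GRing.Theory Num.Theory.
Local Open Scope ring_scope.

(** Let [N] be the [p] x [q] biadjacency matrix. Rows of [N] indexed by vertices
    of the same [A i] coincide, and so do the rows indexed by vertices of [U]
    outside all [A i], so [N = L M] with [k + 1] intermediate indices. Hence the
    adjacency matrix is [L M + (L M)^T], the product of [row_mx L M^T] and
    [col_mx M L^T]. Since [X Y] and [Y X] have the same characteristic
    polynomial up to a power of the variable, and [M L = 0], it suffices to treat
    the antidiagonal block matrix with blocks [M M^T] and [L^T L], whose
    characteristic polynomial is that of [M M^T L^T L] evaluated at [x^2]. With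
    the right scaling of the last index, [M M^T L^T L] is exactly [Z'], and a
    product of two Gram matrices has real nonnegative eigenvalues. *)

(** * Characteristic polynomials and eigenvalues of matrix products *)

(** The block matrix [B] with rows [x, L] and [M, 1] becomes block triangular after right
    multiplication by either of two triangular matrices. One leaves [x - L M] on the diagonal, the
    other [x - M L]. Comparing determinants gives the identity without dividing by [x]. *)
Lemma det_schur (R : comPzRingType) m n (x : R) (L : 'M[R]_(n, m))
    (M : 'M[R]_(m, n)) :
  x ^+ m * \det (x%:M - L *m M) = x ^+ n * \det (x%:M - M *m L).
Proof.
pose B := block_mx x%:M L M (1%:M : 'M_m).
have detB : \det B = \det (x%:M - L *m M).
  have := det_mulmx B (block_mx 1%:M 0 (- M) 1%:M).
  rewrite mulmx_block !mulmx1 !mulmx0 !mul1mx mulmxN subrr !add0r det_ublock.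
  by rewrite det_lblock !det1 !mulr1.
have := det_mulmx B (block_mx 1%:M (- L) 0 x%:M).
rewrite mulmx_block !mulmx1 !mulmx0 !mul1mx !mulmxN !addr0 mul_scalar_mx.
rewrite mul_mx_scalar addNr det_lblock det_ublock det1 !det_scalar mul1r detB.
by rewrite addrC => ->; rewrite mulrC.
Qed.

Lemma char_poly_mulC (R : comNzRingType) m n (L : 'M[R]_(n, m))
    (M : 'M[R]_(m, n)) :
  'X^m * char_poly (L *m M) = 'X^n * char_poly (M *m L).
Proof. by rewrite /char_poly /char_poly_mx !map_mxM det_schur. Qed.

(** Right multiplication by [N] clears the lower left block of the characteristic matrix and leaves
    [X^2 - S D] and [X^2] on the diagonal. Since [\det N] is a nonzero power of [X], it can be
    cancelled. *)
Lemma char_poly_antidiag_block (R : idomainType) m (S D : 'M[R]_m) :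
  char_poly (block_mx 0 S D 0) = char_poly (S *m D) \Po 'X^2.
Proof.
set S' := map_mx polyC S; set D' := map_mx polyC D.
pose N : 'M[{poly R}]_(m + m) := block_mx 'X%:M 0 D' 'X%:M.
have detN : \det N = 'X ^+ m * 'X ^+ m by rewrite det_lblock det_scalar.
have detN_neq0 : \det N != 0 by rewrite detN -exprD expf_neq0 ?polyX_eq0.
apply: (mulIf detN_neq0); rewrite -det_mulmx /char_poly_mx map_block_mx.
rewrite !map_mx0 -/S' -/D' (scalar_mx_block m m) opp_block_mx add_block_mx.
rewrite !oppr0 !addr0 !add0r mulmx_block !mulmx0 !mul_mx_scalar.
rewrite !mul_scalar_mx !scalerN addNr det_ublock scale_scalar_mx.
rewrite add0r mulNmx det_scalar detN /char_poly.
(* Substituting [X^2] is a ring morphism, so it moves inside the determinant, where it fixes the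
   constant entries of [S'] and [D']. *)
rewrite -(det_map_mx (comp_poly 'X^2)) /char_poly_mx map_mxB map_scalar_mx.
rewrite /= comp_polyX map_mxM -/S' -/D'.
have -> : map_mx (comp_poly 'X^2) (S' *m D') = S' *m D'.
  by rewrite map_mxM; congr (_ *m _); apply/matrixP=> i j;
    rewrite !mxE /= comp_polyC.
by rewrite -expr2 exprMn -expr2 -expr2.
Qed.

(* With w = v M M^T, the equation v (M M^T)(L^T L) = z v pairs with the adjoint
   of w to give |w L^T|^2 = z |v M|^2, and v M = 0 forces z v = 0. *)
Lemma eigenvalue_mul_gram (R : rcfType) m n n' (M : 'M[R]_(m, n))
    (L : 'M[R]_(n', m)) (z : R[i]) :
  eigenvalue (map_mx (real_complex R) (M *m M^T *m (L^T *m L))) z -> 0 <= z.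
Proof.
pose sq l (u : 'rV[R[i]]_l) := \sum_j `|u 0 j| ^+ 2.
have sqE l (u : 'rV[R[i]]_l) : u *m (map_mx Num.conj u)^T = (sq l u)%:M.
  apply/matrixP=> i j; rewrite !ord1 !mxE eqxx mulr1n.
  by apply: eq_bigr => t _; rewrite !mxE normCK.
have sq_ge0 l (u : 'rV[R[i]]_l) : 0 <= sq l u.
  by apply: sumr_ge0 => j _; rewrite exprn_ge0.
have conjR l l' (P : 'M[R]_(l, l')) :
    map_mx Num.conj (map_mx (real_complex R) P) = map_mx (real_complex R) P.
  apply/matrixP=> i j; rewrite !mxE; apply: conj_Creal.
  by apply/complex_realP; exists (P i j).
rewrite !map_mxM -!map_trmx.
set M' := map_mx _ M; set L' := map_mx _ L.
case/eigenvalueP => v vE v_neq0.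
have key : sq _ (v *m M' *m M'^T *m L'^T) = z * sq _ (v *m M').
  suff: (sq _ (v *m M' *m M'^T *m L'^T))%:M
        = (z * sq _ (v *m M'))%:M :> 'M[R[i]]_1.
    by move/matrixP/(_ 0 0); rewrite !mxE !mulr1n.
  rewrite -scale_scalar_mx -!sqE !map_mxM -!map_trmx !conjR !trmx_mul !trmxK.
  by rewrite -/M' -/L' !scalemxAl -vE !mulmxA.
have [sq0 | sq_neq0] := eqVneq (sq _ (v *m M')) 0.
  have vM0 : v *m M' = 0.
    apply/matrixP=> i j; rewrite ord1 [RHS]mxE; apply/eqP.
    have := psumr_eq0P (fun j _ => exprn_ge0 2 (normr_ge0 _)) sq0.
    by move/(_ j isT)/eqP; rewrite expf_eq0 normr_eq0.
  move: vE; rewrite !mulmxA vM0 !mul0mx => /esym/eqP.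
  by rewrite scaler_eq0 (negPf v_neq0) orbF => /eqP ->.
have sq_gt0 : 0 < sq _ (v *m M') by rewrite lt0r sq_neq0 sq_ge0.
by rewrite -(pmulr_lge0 _ sq_gt0) -key sq_ge0.
Qed.

(** * Edges as unordered pairs, and sums of indicators *)

Lemma mem_complete_bip_edges (T : finType) (A B : {set T}) x y :
  ([set x; y] \in complete_bip_edges A B) =
  (x \in A) && (y \in B) || (y \in A) && (x \in B).
Proof.
apply/imset2P/idP => [[a b aA bB xyE] | ]; last first.
  by case/orP=> /andP[Ha Hb]; [exists x y | exists y x] => //; rewrite setUC.
have /orP ha : (a == x) || (a == y) by rewrite -in_set2 xyE set21.
have /orP hb : (b == x) || (b == y) by rewrite -in_set2 xyE set22.
have /orP hx : (x == a) || (x == b) by rewrite -in_set2 -xyE set21.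
have /orP hy : (y == a) || (y == b) by rewrite -in_set2 -xyE set22.
have [eq_xa | ne_xa] := eqVneq x a.
  have [<- | ne_yb] := eqVneq b y; first by rewrite eq_xa aA bB.
  (* The elements of a pair may coincide here: if [x = a] and [b] differs from [y], then [b = x] and
     [y = a], so all four are equal. *)
  have bx : b = x by case: hb => /eqP // eby; rewrite eby eqxx in ne_yb.
  have ya : y = a.
    by case: hy => /eqP // yb; rewrite yb eqxx in ne_yb.
  have -> : y = b by rewrite bx ya.
  by rewrite eq_xa aA bB.
have xb : x = b by case: hx => /eqP // xa; rewrite xa eqxx in ne_xa.
have ya : y = a by case: ha => /eqP // ax; rewrite ax eqxx in ne_xa.
by rewrite xb ya aA bB orbT.
Qed.

Lemma sum_enum_indicator (R : pzSemiRingType) (T : finType) (A : {set T}) :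
  \sum_(i < #|T|) (enum_val i \in A)%:R = #|A|%:R :> R.
Proof.
rewrite -(big_enum_val (A := T) (fun x => (x \in A)%:R)) -natr_sum.
by rewrite -big_mkcond sum1_card.
Qed.

Lemma card_bigcup_disjoint (T : finType) k (A : 'I_k -> {set T}) :
  (forall i j, i != j -> [disjoint A i & A j]) ->
  #|\bigcup_i A i| = (\sum_i #|A i|)%N.
Proof.
move=> dis; rewrite -sum1_card partition_disjoint_bigcup //.
by apply: eq_bigr => i _; rewrite sum1_card.
Qed.

Lemma sum_indicator_disjoint (R : pzSemiRingType) (T : finType) k
    (A : 'I_k -> {set T}) x :
  (forall i j, i != j -> [disjoint A i & A j]) ->
  \sum_i (x \in A i)%:R = (x \in \bigcup_i A i)%:R :> R.
Proof.
move=> dis; case: bigcupP => [[i _ xAi] | nex].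
  rewrite (bigD1 i) //= xAi big1 ?addr0 // => j ne_ji.
  by rewrite (disjointFl (dis _ _ ne_ji)).
rewrite big1 // => i _; case: (boolP (x \in A i)) => // xAi.
by case: nex; exists i.
Qed.

(** * The two factors of the biadjacency matrix and their Gram matrices *)

(* The last index stands for the vertices of [U] outside all [A i].  In the
   application [c ^+ 2] is their number, so that [c = 0], where [_ / c] is the
   junk value [0], happens only when there are none. *)
Definition bip_left (R : fieldType) (T : finType) k (U : {set T})
    (A : 'I_k -> {set T}) (c : R) : 'M[R]_(#|T|, k + 1) :=
  row_mx (\matrix_(x, i) (enum_val x \in A i)%:R)
         (\col_x ((enum_val x \in U :\: \bigcup_i A i)%:R / c)).

(** For [B i] inside [V], row [i] is the common row of the vertices of [A i]: -1 on [B i] and 1 on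
    the rest of [V]. The factor [c] in the last row offsets the division by [c] in [bip_left].
    Columns range over all vertices, so that products with [bip_left] are square. *)
Definition bip_right (R : fieldType) (T : finType) k (V : {set T})
    (B : 'I_k -> {set T}) (c : R) : 'M[R]_(k + 1, #|T|) :=
  col_mx (\matrix_(i, y) ((enum_val y \in V)%:R - 2 * (enum_val y \in B i)%:R))
         (\row_y (c * (enum_val y \in V)%:R)).

Arguments bip_left {R T k} U A c.
Arguments bip_right {R T k} V B c.

(** The columns have pairwise disjoint supports, so only their squared norms survive. *)
Lemma bip_left_gram (R : fieldType) (T : finType) k (U : {set T})
    (A : 'I_k -> {set T}) (c : R) :
  (forall i j, i != j -> [disjoint A i & A j]) ->
  (bip_left U A c)^T *m bip_left U A c =
  block_mx (diag_mx (\row_i #|A i|%:R)) 0 0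
           (#|U :\: \bigcup_i A i|%:R / c ^+ 2)%:M.
Proof.
move=> disA; rewrite tr_row_mx mul_col_row; congr block_mx.
- apply/matrixP=> i j; rewrite !mxE.
  under eq_bigr => x _ do rewrite !mxE -natrM mulnb -in_setI.
  rewrite sum_enum_indicator.
  have [-> | /disA] := eqVneq i j; first by rewrite setIid.
  by rewrite -setI_eq0 => /eqP ->; rewrite cards0.
- apply/matrixP=> i j; rewrite !mxE big1 // => x _; rewrite !mxE inE.
  case: bigcupP => [_ | nex]; first by rewrite mul0r mulr0.
  case: (boolP (_ \in A i)) => [xA | _]; last by rewrite mul0r.
  by case: nex; exists i.
- apply/matrixP=> i j; rewrite !mxE big1 // => x _; rewrite !mxE inE.
  case: bigcupP => [_ | nex]; first by rewrite !mul0r.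
  case: (boolP (_ \in A j)) => [xA | _]; last by rewrite mulr0.
  by case: nex; exists j.
- apply/matrixP=> i j; rewrite !ord1 !mxE eqxx mulr1n.
  rewrite -sum_enum_indicator mulr_suml; apply: eq_bigr => x _; rewrite !mxE.
  by rewrite mulrACA -natrM mulnb andbb -invfM -expr2.
Qed.

(** Two of the first [k] rows have inner product [|V| - 2|B i| - 2|B j| + 4|B i :&: B j|]. The last
    term vanishes for [i != j] and cancels the two before it for [i = j]. *)
Lemma bip_right_gram (R : fieldType) (T : finType) k (V : {set T})
    (B : 'I_k -> {set T}) (c : R) :
  (forall i, B i \subset V) ->
  (forall i j, i != j -> [disjoint B i & B j]) ->
  bip_right V B c *m (bip_right V B c)^T =
  block_mx
    (\matrix_(i, j) if i == j then #|V|%:R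
                    else #|V|%:R - 2 * #|B i|%:R - 2 * #|B j|%:R)
    (\col_i (c * (#|V|%:R - 2 * #|B i|%:R)))
    (\row_j (c * (#|V|%:R - 2 * #|B j|%:R)))
    (c ^+ 2 * #|V|%:R)%:M.
Proof.
move=> subB disB; rewrite tr_col_mx mul_col_row.
have VB i x : (x \in V)%:R * (x \in B i)%:R = (x \in B i)%:R :> R.
  by rewrite -natrM mulnb -in_setI (setIidPr (subB i)).
have VV x : (x \in V)%:R * (x \in V)%:R = (x \in V)%:R :> R.
  by rewrite -natrM mulnb andbb.
have sumV (b : R) i :
    \sum_(x < #|T|) b * ((enum_val x \in V)%:R - 2 * (enum_val x \in B i)%:R)
    = b * (#|V|%:R - 2 * #|B i|%:R).
  by rewrite -mulr_sumr sumrB -mulr_sumr !sum_enum_indicator.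
congr block_mx; apply/matrixP=> i j.
- rewrite !mxE.
  pose F x : R := (x \in V)%:R - 2 * (x \in B i)%:R - 2 * (x \in B j)%:R
                  + 4 * (x \in B i :&: B j)%:R.
  rewrite (eq_bigr (fun x => F (enum_val x))); last first.
    move=> x _; rewrite !mxE /F in_setI -mulnb natrM.
    set v := (_ \in V)%:R; have Bi := VB i (enum_val x).
    have Bj := VB j (enum_val x); have Vx := VV (enum_val x).
    rewrite -/v in Bi Bj Vx; rewrite mulrBl !mulrBr Vx.
    by rewrite mulrCA Bj -(mulrA 2) (mulrC _ v) Bi; ring.
  rewrite /F big_split !sumrB /= -!mulr_sumr !sum_enum_indicator.
  have [-> | /disB] := eqVneq i j; first by rewrite setIid; ring.
  by rewrite -setI_eq0 => /eqP ->; rewrite cards0 mulr0 addr0.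
- rewrite !mxE -sumV; apply: eq_bigr => x _; rewrite !mxE.
  rewrite mulrCA mulrBl VV -mulrA (mulrC (_ \in B i)%:R) VB; ring.
- rewrite !mxE -sumV; apply: eq_bigr => x _; rewrite !mxE.
  rewrite -mulrA mulrBr VV mulrCA VB; ring.
- rewrite !ord1 !mxE eqxx mulr1n -sum_enum_indicator mulr_sumr.
  by apply: eq_bigr => x _; rewrite !mxE mulrACA VV -expr2.
Qed.

(** The rows of [bip_right] are supported on [V] and the columns of [bip_left] on [U]. *)
Lemma bip_right_left (R : fieldType) (T : finType) k (U V : {set T})
    (A B : 'I_k -> {set T}) (c : R) :
  [disjoint U & V] ->
  (forall i, A i \subset U) -> (forall i, B i \subset V) ->
  bip_right V B c *m bip_left U A c = 0.
Proof.
move=> dUV subA subB.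
have inV x : x \in U -> x \in V = false by exact: disjointFr.
have inB x i : x \in U -> x \in B i = false.
  by move/inV => xV; apply: contraFF xV; apply/subsetP.
apply/matrixP=> i j; rewrite !mxE big1 // => x _.
have [xU | xU] := boolP (enum_val x \in U).
  rewrite mxE; case: split => l; rewrite !mxE inV ?inB //.
    by rewrite mulr0 subr0 mul0r.
  by rewrite mulr0 mul0r.
have inA l : enum_val x \in A l = false.
  by apply: contraNF xU; apply/subsetP.
rewrite [X in _ * X]mxE; case: split => l; rewrite !mxE ?inA ?mulr0 //.
by rewrite inE (negPf xU) andbF mul0r mulr0.
Qed.

(** The indicators of the [A i] and of the rest of [U] add up to that of [U], which collects the
    terms in [V]. *)
Lemma bip_left_right (R : fieldType) (T : finType) k (U V : {set T})
    (A B : 'I_k -> {set T}) (c : R) x y :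
  (forall i, A i \subset U) ->
  (forall i j, i != j -> [disjoint A i & A j]) ->
  (c = 0 -> U \subset \bigcup_i A i) ->
  (bip_left U A c *m bip_right V B c) x y =
  (enum_val x \in U)%:R * (enum_val y \in V)%:R
  - 2 * \sum_i (enum_val x \in A i)%:R * (enum_val y \in B i)%:R.
Proof.
move=> subA disA c0.
rewrite mul_row_col !mxE big_ord1 !mxE.
under [X in X + _]eq_bigr => i _ do rewrite !mxE mulrBr mulrCA.
rewrite sumrB -mulr_sumr -mulr_suml sum_indicator_disjoint //.
rewrite addrAC; congr (_ - _); rewrite mulrA -mulrDl; congr (_ * _).
rewrite inE; have [xA | xA] := boolP (_ \in \bigcup_i A i).
  have -> : enum_val x \in U.
    by case/bigcupP: xA => i _; apply/subsetP.
  by rewrite !mul0r addr0.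
rewrite add0r /=; have [xU | _] := boolP (_ \in U); last by rewrite !mul0r.
(* Here the vertex lies in [U] outside all [A i], so [c] is nonzero and cancels. *)
rewrite mulfVK //; apply: contra xA => /eqP/c0/subsetP; exact.
Qed.

(** * Factorization of the adjacency matrix *)

(** At most one [A i] contains the vertex numbered [x], so the sum is 1 on negative edges and 0 on
    positive ones. *)
Lemma sg_adjmx_complete_bipartite (R : fieldType) (T : finType)
    (G : signed_graph T) k (U V : {set T}) (A B : 'I_k -> {set T}) :
  complete_bipartite G U V ->
  (forall i, A i \subset U) ->
  (forall i j, i != j -> [disjoint A i & A j]) ->
  negative_edges G = \bigcup_(i < k) complete_bip_edges (A i) (B i) ->
  forall x y, enum_val x \in U -> enum_val y \in V ->
  sg_adjmx R G x y =
  1 - 2 * \sum_i (enum_val x \in A i)%:R * (enum_val y \in B i)%:R.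
Proof.
case=> _ dUV edgesE subA disA negE x y xU yV; rewrite mxE /=.
set e := [set _; _].
have e_edge : e \in sg_edges G by rewrite edgesE mem_complete_bip_edges xU yV.
have eE i : (e \in complete_bip_edges (A i) (B i)) =
    (enum_val x \in A i) && (enum_val y \in B i).
  (* This excludes the reversed orientation of the edge. *)
  have yA : enum_val y \in A i = false.
    by apply: contraTF yV => /(subsetP (subA i)) yU; rewrite (disjointFr dUV).
  by rewrite mem_complete_bip_edges yA orbF.
have : (e \in negative_edges G) = (sg_sign G e == -1) by rewrite inE e_edge.
rewrite e_edge negE; case: bigcupP => [[i _ ei] | nex] sgnE.
  move: ei; rewrite eE => /andP[xA yB]; rewrite (bigD1 i) //= xA yB mulr1 big1.
    by rewrite (eqP (esym sgnE)) addr0 mulr1 rmorphN1; ring.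
  by move=> j ne_ji; rewrite (disjointFl (disA _ _ ne_ji)) // mul0r.
have [sg | ->] := sg_signP e_edge; first by rewrite sg eqxx in sgnE.
rewrite big1 ?mulr0 ?subr0 // => i _; rewrite -natrM mulnb.
by case: andP => // /andP xyi; case: nex; exists i; rewrite ?eE.
Qed.

Lemma sg_adjmx_sym (R : pzRingType) (T : finType) (G : signed_graph T) :
  (sg_adjmx R G)^T = sg_adjmx R G.
Proof. by apply/matrixP=> x y; rewrite !mxE setUC. Qed.

(** For vertices on opposite sides exactly one of the two summands contributes; for vertices on the
    same side both vanish. *)
Lemma sg_adjmx_bip_factor (R : fieldType) (T : finType)
    (G : signed_graph T) k (U V : {set T}) (A B : 'I_k -> {set T}) (c : R) :
  complete_bipartite G U V ->
  (forall i, A i \subset U) -> (forall i, B i \subset V) ->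
  (forall i j, i != j -> [disjoint A i & A j]) ->
  negative_edges G = \bigcup_(i < k) complete_bip_edges (A i) (B i) ->
  (c = 0 -> U \subset \bigcup_i A i) ->
  sg_adjmx R G = bip_left U A c *m bip_right V B c
                 + (bip_left U A c *m bip_right V B c)^T.
Proof.
move=> bipG subA subB disA negE c0.
have adjE :=
  sg_adjmx_complete_bipartite R T G k U V A B bipG subA disA negE.
have [UV dUV edgesE] := bipG.
have inV x : (x \in V) = (x \notin U).
  have := in_setT x; rewrite -UV inE.
  by case: (boolP (x \in U)) => //= xU _; rewrite (disjointFr dUV).
have A0 x i : x \notin U -> x \in A i = false.
  by move=> xU; apply: contraNF xU; apply/subsetP.
have B0 x i : x \in U -> x \in B i = false.
  by rewrite -[_ \in U]negbK -inV; apply: contraNF; apply/subsetP.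
apply/matrixP=> x y; rewrite [in RHS]mxE [_^T x y]mxE !bip_left_right //.
have [xU | xU] := boolP (enum_val x \in U);
  have [yU | yU] := boolP (enum_val y \in U).
- rewrite mxE /= edgesE mem_complete_bip_edges !inV xU yU /=.
  by rewrite !big1 => [|i _|i _]; rewrite ?B0 // ?mulr0 //; ring.
- rewrite adjE ?inV // ?inV xU yU /= [X in _ + (_ - _ * X)]big1 => [|i _].
    by ring.
  by rewrite A0 // mul0r.
(* Symmetry exchanges [x] and [y], so that the formula for a row in [U] and a column in [V]
   applies. *)
- rewrite -sg_adjmx_sym mxE adjE ?inV // ?inV xU yU /=.
  rewrite [X in _ - _ * X + _]big1 => [|i _]; first by ring.
  by rewrite A0 // mul0r.
- rewrite mxE /= edgesE mem_complete_bip_edges !inV (negPf xU) (negPf yU) /=.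
  by rewrite !big1 => [|i _|i _]; rewrite ?A0 // ?mul0r //; ring.
Qed.

(** * Identification of [Zprime] and the characteristic polynomial *)

(** As [c ^+ 2] counts the vertices of [U] outside all [A i], [L^T L] is diagonal with entries [r i]
    and a last entry [c ^+ 2 / c ^+ 2]. It therefore scales the columns of [M M^T]. *)
Lemma Zprime_gram (R : rcfType) (T : finType) p q k (r s : 'I_k -> nat)
    (U V : {set T}) (A B : 'I_k -> {set T}) :
  #|U| = p -> #|V| = q ->
  (forall i, A i \subset U) -> (forall i, B i \subset V) ->
  (forall i, #|A i| = r i) -> (forall i, #|B i| = s i) ->
  (forall i j, i != j -> [disjoint A i & A j]) ->
  (forall i j, i != j -> [disjoint B i & B j]) ->
  (\sum_i r i <= p)%N ->
  let L := bip_left U A (c_scal R p r) in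
  let M := bip_right V B (c_scal R p r) in
  Zprime R p q r s = M *m M^T *m (L^T *m L).
Proof.
move=> cardU cardV subA subB cardA cardB disA disB le_rp L M.
have c2 : c_scal R p r ^+ 2 = p%:R - (\sum_i r i)%N%:R.
  by rewrite sqr_sqrtr // subr_ge0 ler_nat.
have subUA : \bigcup_i A i \subset U by apply/bigcupsP.
have cardW : #|U :\: \bigcup_i A i|%:R = c_scal R p r ^+ 2 :> R.
  rewrite cardsD (setIidPr subUA) card_bigcup_disjoint // cardU.
  by rewrite (eq_bigr _ (fun i _ => cardA i)) natrB.
rewrite bip_left_gram // bip_right_gram // mulmx_block !mulmx0 !addr0 !add0r.
rewrite cardW cardV /Zprime -c2; set c := c_scal R p r.
(* For [c = 0] the quotient is 0 instead of 1, but the factor [c] in the last column of [M M^T]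
   makes both sides vanish. *)
have cdiv : c * (c ^+ 2 / c ^+ 2) = c.
  have [-> | c_neq0] := eqVneq c 0; first by rewrite mul0r.
  by rewrite divff ?mulr1 // expf_neq0.
congr block_mx.
- apply/matrixP=> i j; rewrite mul_mx_diag !mxE cardA !cardB /c_coef.
  by rewrite mulrC.
- apply/matrixP=> i j; rewrite mul_mx_scalar !mxE cardB.
  by rewrite mulrA (mulrC _ c) cdiv.
- apply/matrixP=> i j; rewrite mul_mx_diag !mxE cardA cardB; ring.
- rewrite mul_mx_scalar scale_scalar_mx; congr (_%:M).
  have c2div : c ^+ 2 * (c ^+ 2 / c ^+ 2) = c ^+ 2.
    by rewrite [X in X * _]expr2 -mulrA cdiv.
  by rewrite [RHS]mulrCA [RHS]mulrA c2div mulrC.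
Qed.

(** Swapping the two factors gives a matrix of size [m + m] with diagonal blocks [M L] and
    [(M L)^T], both zero. *)
Lemma char_poly_add_trmx (R : idomainType) m n (L : 'M[R]_(n, m))
    (M : 'M[R]_(m, n)) :
  M *m L = 0 ->
  'X^(m + m) * char_poly (L *m M + (L *m M)^T) =
  'X^n * (char_poly (M *m M^T *m (L^T *m L)) \Po 'X^2).
Proof.
move=> ML0; rewrite trmx_mul -mul_row_col char_poly_mulC mul_col_row ML0.
by rewrite -trmx_mul ML0 trmx0 char_poly_antidiag_block.
Qed.

Theorem theorem4p3 (R : rcfType) (T : finType) (G : signed_graph T)
    (p q k : nat) (r s : 'I_k -> nat)
    (U V : {set T}) (A B : 'I_k -> {set T})
    (le_pq : (p <= q)%N)
    (G_bip : complete_bipartite G U V)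
    (card_U : #|U| = p) (card_V : #|V| = q)
    (A_sub : forall i, A i \subset U) (B_sub : forall i, B i \subset V)
    (card_A : forall i, #|A i| = r i) (card_B : forall i, #|B i| = s i)
    (r_gt0 : forall i, (0 < r i)%N) (s_gt0 : forall i, (0 < s i)%N)
    (AB_disj : forall i j, i != j -> [disjoint A i :|: B i & A j :|: B j])
    (neg_edges :
       negative_edges G = \bigcup_(i < k) complete_bip_edges (A i) (B i))
    (le_rp : (\sum_i r i <= p)%N) (le_sq : (\sum_i s i <= q)%N) :
  (forall z : R[i],
     eigenvalue (map_mx (real_complex R) (Zprime R p q r s)) z ->
     complex.Im z = 0 /\ 0 <= complex.Re z)
  /\ tofrac (char_poly (sg_adjmx R G)) =
     tofrac 'X ^ (p%:Z + q%:Z - 2 * k%:Z - 2)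
     * tofrac (char_poly (Zprime R p q r s) \Po 'X^2)
       :> {fraction {poly R}}.
Proof.
have disA i j : i != j -> [disjoint A i & A j].
  move/AB_disj; apply: disjointW; exact: subsetUl.
have disB i j : i != j -> [disjoint B i & B j].
  move/AB_disj; apply: disjointW; exact: subsetUr.
have [UV dUV _] := G_bip.
set c := c_scal R p r.
have ZE := Zprime_gram R T p q k r s U V A B card_U card_V A_sub B_sub
  card_A card_B disA disB le_rp.
(* If [c = 0] then [p] is the sum of the [r i], so the disjoint sets [A i] fill [U] by
   cardinality. *)
have c0 : c = 0 -> U \subset \bigcup_i A i.
  move/(congr1 (fun x => x ^+ 2)).
  rewrite sqr_sqrtr ?subr_ge0 ?ler_nat // expr0n /= => /eqP.
  rewrite subr_eq0 eqr_nat => /eqP p_r.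
  have /eqP <- // : \bigcup_i A i == U.
  rewrite eqEcard card_U card_bigcup_disjoint // p_r.
  by rewrite (eq_bigr _ (fun i _ => card_A i)) leqnn andbT; apply/bigcupsP.
split=> [z | ].
  (* In the order on [R[i]], [0 <= z] already includes that [z] is real. *)
  rewrite ZE => /eigenvalue_mul_gram; rewrite lecE => /andP[/eqP Im0 Re0].
  by split.
have cardT : #|T| = (p + q)%N.
  by rewrite -cardsT -UV cardsU disjoint_setI0 // cards0 subn0 card_U card_V.
have ML0 := bip_right_left R T k U V A B c dUV A_sub B_sub.
have := char_poly_add_trmx _ _ _ _ _ ML0.
rewrite -(sg_adjmx_bip_factor R T G k U V A B c) // -ZE => charE.
have X_neq0 : tofrac ('X : {poly R}) != 0 by rewrite tofrac_eq0 polyX_eq0.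
(* The exponent can be negative (it is -2 for [p = q = k]), hence the field of fractions.
   Multiplying by [X^(2k+2)] reduces the claim to the polynomial identity [charE]. *)
apply: (mulfI (expf_neq0 (k + 1 + (k + 1)) X_neq0)).
rewrite -tofracXn -tofracM charE tofracM tofracXn mulrA; congr (_ * _).
rewrite tofracXn !exprnP -expfzDr // cardT; congr (_ ^ _).
by rewrite !PoszD; ring.
Qed.
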